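(* Let $P=(p_1,p_2,p_3,p_4)$ and $Q=(q_1,q_2,q_3,q_4)$ be two quadrilaterals in a 2-dimensional real vector space with parallel corresponding edges, $p_{i+1}-p_i\parallel q_{i+1}-q_i$ for $i\in\mathbb{Z}\pmod 4$. Then $P$ and $Q$ are dual, i.e. $A(P,Q)=0$, if and only if their non-corresponding diagonals are parallel: $$(p_1p_3)\parallel(q_2q_4),\qquad (p_2p_4)\parallel(q_1q_3).$$
   Context: Vectors $v,w$ are parallel, $v\parallel w$, if they are linearly dependent; $(p_1p_3)\parallel(q_2q_4)$ means $p_3-p_1\parallel q_4-q_2$, and similarly for the other pair. For polygons in a 2-dimensional vector space with a fixed nonzero determinant form, the oriented area of $P=(p_1,\dots,p_n)$ is $A(P)=\frac12\sum_{i}\det(p_i,p_{i+1})$ (indices mod $n$), and $A(P,Q)$ denotes the symmetric bilinear form associated with this quadratic form: $A(\lambda P+\mu Q)=\lambda^2A(P)+2\lambda\mu A(P,Q)+\mu^2A(Q)$, sums of polygons being vertex-wise. *)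

(* Defs.v *)
From HB Require Import structures.
From mathcomp Require Import all_boot all_order all_algebra.
From mathcomp Require Import reals.
From mathcomp Require Import ring.

Set Implicit Arguments.
Unset Strict Implicit.
Unset Printing Implicit Defensive.

Import Order.TTheory GRing.Theory Num.Theory.
Local Open Scope ring_scope.

Definition parallel (R : realType) (V : vectType R) (v w : V) : Prop :=
  ~~ free [:: v; w].

Definition determinant_form (R : realType) (V : vectType R)
    (D : {biscalar V}) : Prop :=
  (forall v : V, D v v = 0) /\ (exists v w : V, D v w <> 0).

(* Vertices are indexed from 0, so [P i] is the vertex usually called
   p_(i+1); sums and multiples of polygons are those of {ffun _}, hence
   vertex-wise. *)
Notation polygon V n := {ffun 'I_n -> V}.

(* ordS is the successor modulo n. *)
Definition area (R : realType) (V : vectType R) (D : {biscalar V}) (n : nat)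
    (P : polygon V n) : R :=
  2^-1 * \sum_(i < n) D (P i) (P (ordS i)).

(* Polarization of [area]; the three lemmas below show that this is the
   symmetric bilinear form associated with that quadratic form. *)
Definition mixed_area (R : realType) (V : vectType R) (D : {biscalar V})
    (n : nat) (P Q : polygon V n) : R :=
  2^-1 * (area D (P + Q) - area D P - area D Q).

Definition dual (R : realType) (V : vectType R) (D : {biscalar V})
    (n : nat) (P Q : polygon V n) : Prop :=
  mixed_area D P Q = 0.

Section MixedArea.
Variables (R : realType) (V : vectType R) (D : {biscalar V}) (n : nat).
Implicit Types (P Q S : polygon V n) (l m : R).

Let cross P Q : R := \sum_(i < n) D (P i) (Q (ordS i)).

Let area_lin l m P Q : area D (l *: P + m *: Q) =
  l ^+ 2 * area D P + l * m * (2^-1 * (cross P Q + cross Q P))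
  + m ^+ 2 * area D Q.
Proof.
have -> : area D (l *: P + m *: Q) = 2^-1 *
    (l ^+ 2 * cross P P + l * m * cross P Q + l * m * cross Q P
     + m ^+ 2 * cross Q Q).
  rewrite /area /cross; congr (_ * _).
  rewrite !mulr_sumr -!big_split /=; apply: eq_bigr => i _.
  rewrite !ffunE linearDl !linearDr !linearZl_LR !linearZr_LR /=.
  by ring.
by rewrite /area -!/(cross _ _); ring.
Qed.

Let mixed_areaE P Q : mixed_area D P Q = 4^-1 * (cross P Q + cross Q P).
Proof.
rewrite /mixed_area -{1}[P]scale1r -{1}[Q]scale1r area_lin; by field.
Qed.

Lemma area_comb l m P Q : area D (l *: P + m *: Q) =
  l ^+ 2 * area D P + 2 * l * m * mixed_area D P Q + m ^+ 2 * area D Q.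
Proof. by rewrite area_lin mixed_areaE; field. Qed.

Lemma mixed_areaC P Q : mixed_area D P Q = mixed_area D Q P.
Proof. by rewrite !mixed_areaE addrC. Qed.

Lemma mixed_area_linear l P Q S :
  mixed_area D (l *: P + Q) S = l * mixed_area D P S + mixed_area D Q S.
Proof.
rewrite !mixed_areaE /cross -!big_split /= !mulr_sumr -big_split /=.
apply: eq_bigr => i _; rewrite !ffunE linearDl linearDr linearZl_LR linearZr_LR /=.
by ring.
Qed.

End MixedArea.

(* Main.v *)
Require Import Defs.
From mathcomp Require Import all_boot all_order all_algebra.
From mathcomp Require Import reals.
From mathcomp Require Import ring lra.

Import Order.TTheory GRing.Theory Num.Theory.
Local Open Scope ring_scope.

(** The oriented area of a quadrilateral is half the determinant of its
diagonals ([area4]), so polarization gives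
  4 A(P,Q) = X + Y,  X = det(p1p3, q2q4),  Y = det(q1q3, p2p4)
([mixed_area4]).  On the other hand, X - Y is an alternating sum of the four
determinants of corresponding edges ([diagonals_sub_edges]), which all vanish
when corresponding edges are parallel.  Hence X = Y, and A(P,Q) = 0 exactly
when X and Y both vanish, that is, when the non-corresponding diagonals are
parallel: in dimension 2 being parallel is the vanishing of the determinant
([parallelP]).  The argument is an identity followed by linear algebra over
the reals, so degenerate quadrilaterals require no separate treatment. *)

Section Alternating.
Variables (R : realType) (V : vectType R) (D : {biscalar V}).
Hypothesis Dvv : forall v, D v v = 0.

Lemma alternating_anti v w : D w v = - D v w.
Proof.
have := Dvv (v + w); rewrite linearDl !linearDr /= !Dvv add0r addr0 => /eqP.
by rewrite addrC addr_eq0 => /eqP.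
Qed.

Lemma alternating_parallel v w : parallel v w -> D v w = 0.
Proof.
rewrite /parallel free_cons seq1_free span_seq1 negb_and !negbK.
case/orP => [/vlineP[k ->] | /eqP ->]; last by rewrite linear0r.
by rewrite linearZl_LR /= Dvv mulr0.
Qed.

(** If v and w were independent they would form a basis of the plane, and an
alternating form vanishing on a basis is zero. *)
Lemma parallelP v w : \dim {:V} = 2%N -> (exists x y, D x y <> 0) ->
  parallel v w <-> D v w = 0.
Proof.
move=> dimV [x [y Dxy]]; split; first exact: alternating_parallel.
move=> Dvw; apply/negP => vw_free; apply: Dxy.
have Dwv : D w v = 0 by rewrite alternating_anti Dvw oppr0.
have spanE : <<[:: v; w]>>%VS = fullv.
  by apply/eqP; rewrite eqEdim subvf dimV (eqP vw_free).
have comb z : exists a b, z = a *: v + b *: w.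
  have : z \in <<[:: v; w]>>%VS by rewrite spanE memvf.
  rewrite span_cons span_seq1 => /memv_addP[_ /vlineP[a ->]].
  by case=> _ /vlineP[b ->] ->; exists a, b.
have [a [b ->]] := comb x; have [c [d ->]] := comb y.
rewrite linearDl !linearDr /= !linearZl_LR !linearZr_LR /= !Dvv Dvw Dwv.
by rewrite !mulr0 !addr0.
Qed.

(** Write a_i, b_i for the edges.  As they sum to zero, a_3 = -(a_0+a_1+a_2)
and likewise for b_3, so D(a_3,b_3) = D(a_0+a_1+a_2, b_0+b_1+b_2).  The mixed
products D(a_i,b_j), i <> j, in its expansion are the ones in
D(a_0+a_1, b_1+b_2) + D(a_1+a_2, b_0+b_1), which is the left-hand side since D
is antisymmetric; the two expressions differ only in the products
D(a_i,b_i). *)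
Lemma diagonals_sub_edges (p0 p1 p2 p3 q0 q1 q2 q3 : V) :
  D (p2 - p0) (q3 - q1) - D (q2 - q0) (p3 - p1) =
  - D (p1 - p0) (q1 - q0) + D (p2 - p1) (q2 - q1)
  - D (p3 - p2) (q3 - q2) + D (p0 - p3) (q0 - q3).
Proof.
rewrite (alternating_anti (p3 - p1)) !linearBl !linearBr /=.
by ring.
Qed.

(** The edge determinants D(p_i,p_(i+1)) of consecutive vertices are the four
terms of D(p_2-p_0, p_3-p_1), up to antisymmetry. *)
Lemma area4 (P : polygon V 4) : area D P = 2^-1 * D (P 2 - P 0) (P 3 - P 1).
Proof.
have -> : area D P =
    2^-1 * (D (P 0) (P 1) + D (P 1) (P 2) + D (P 2) (P 3) + D (P 3) (P 0)).
  rewrite /area !big_ord_recl big_ord0 addr0 !addrA.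
  by congr (_ * (D (P _) (P _) + D (P _) (P _) + D (P _) (P _) + D (P _) (P _)));
    apply: val_inj.
rewrite !linearBl !linearBr /=.
rewrite (alternating_anti (P 1) (P 2)) (alternating_anti (P 0) (P 3)).
by ring.
Qed.

Lemma mixed_area4 (P Q : polygon V 4) : 4 * mixed_area D P Q =
  D (P 2 - P 0) (Q 3 - Q 1) + D (Q 2 - Q 0) (P 3 - P 1).
Proof.
rewrite /mixed_area !area4 !ffunE !opprD !linearDl !linearDr /=.
rewrite !linearNl !linearNr /=.
by field.
Qed.

End Alternating.

Theorem theorem12 (R : realType) (V : vectType R) (dimV : \dim {:V} = 2%N)
  (D : {biscalar V}) (hD : determinant_form D) (P Q : polygon V 4)
  (hPQ : forall i : 'I_4, parallel (P (ordS i) - P i) (Q (ordS i) - Q i)) :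
  dual D P Q <->
  parallel (P 2 - P 0) (Q 3 - Q 1) /\ parallel (P 3 - P 1) (Q 2 - Q 0).
Proof.
have [Dvv Dn0] := hD.
have edge (i j : 'I_4) : ordS i = j -> D (P j - P i) (Q j - Q i) = 0.
  by move=> <-; apply: alternating_parallel.
(* The edges being parallel, X = Y. *)
have XY := diagonals_sub_edges _ _ _ Dvv
  (P 0) (P 1) (P 2) (P 3) (Q 0) (Q 1) (Q 2) (Q 3).
rewrite !edge in XY; try exact: val_inj.
have A4 := mixed_area4 _ _ _ Dvv P Q.
rewrite /dual !(parallelP _ _ _ Dvv _ _ dimV Dn0).
rewrite (alternating_anti _ _ _ Dvv (Q 2 - Q 0)).
split=> [A0|[X0 Y0]]; last by lra.
by rewrite A0 in A4; split; lra.
Qed.
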